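(* Let $\pi=\pi_1\cdots\pi_n\in S_n$ be a sorted permutation with exactly $k$ descents $d_1<\cdots<d_k$, and set $d_0=0$ and $d_{k+1}=n$. Let $\mathcal H^*=(H_1^*,\ldots,H_k^* )$ be the canonical valid hook configuration of $\pi$, and let $(q_0^*,\ldots,q_k^* )$, $e_0,\ldots,e_k$ and $\alpha_1,\ldots,\alpha_{k+1}$ be the parameters associated with it (as defined in the context). A composition $(q_0,\ldots,q_k)$ of $n-k$ into $k+1$ parts is a valid composition of $\pi$ if and only if the following two conditions hold: (a) For every $m\in\{0,\ldots,k\}$, $$\sum_{j=m}^{e_m-1}q_j\geq\sum_{j=m}^{e_m-1}q_j^*.$$ (b) For all $m,p\in\{0,1,\ldots,k\}$ with $m\leq p\leq e_m-2$, we have $$\sum_{j=m}^pq_j\geq d_{p+1}-d_m-\sum_{j=m+1}^{p+1}\alpha_j.$$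
   Context: $S_n$ is the set of permutations of $\{1,\ldots,n\}$, written as words. A descent of $\pi=\pi_1\cdots\pi_n$ is an index $i\in\{1,\ldots,n-1\}$ with $\pi_i>\pi_{i+1}$. The stack-sorting map $s$ is defined recursively on words of distinct positive integers: $s$ sends the empty word to itself, and if $\pi=LNR$ where $N$ is the largest entry of $\pi$, then $s(\pi)=s(L)s(R)N$. A permutation $\pi$ is sorted if $s^{-1}(\pi)\neq\emptyset$. A composition of $b$ into $a$ parts is an $a$-tuple of positive integers whose sum is $b$. Hooks. The plot of $\pi$ is the set of points $(i,\pi_i)$, $1\le i\le n$. A point $(i,\pi_i)$ is a descent top if $i$ is a descent. For $i<j$ with $\pi_i<\pi_j$, the hook with southwest endpoint $(i,\pi_i)$ and northeast endpoint $(j,\pi_j)$ is the union of the vertical segment from $(i,\pi_i)$ to $(i,\pi_j)$ and the horizontal segment from $(i,\pi_j)$ to $(j,\pi_j)$. A valid hook configuration of $\pi$ is a configuration $\mathcal H=(H_1,\ldots,H_k)$ of hooks on the plot of $\pi$ such that: 1. the southwest endpoints of the hooks are precisely the descent tops, with $H_i$ having southwest endpoint $(d_i,\pi_{d_i})$; 2. no point of the plot lies directly above a hook (i.e. if $H_i$ has northeast endpoint $(b_i,\pi_{b_i})$, there is no $x$ with $d_i<x<b_i$ and $\pi_x>\pi_{b_i}$); 3. two distinct hooks do not intersect, except that the northeast endpoint of one may be the southwest endpoint of the other. Coloring and valid compositions. A valid hook configuration with northeast endpoints $(b_i,\pi_{b_i})$ induces a coloring of the $n-k$ points of the plot that are not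 northeast endpoints of hooks (the $k$ northeast endpoints are uncolored): each such point looks directly upward and receives the color of the first hook it sees, or the color of the sky if it sees no hook; a point that is the southwest endpoint of a hook looks around the left side of the vertical part of that hook, thus ignoring its own hook. Equivalently, a point $(x,\pi_x)$ that is not a northeast endpoint receives the color of the hook $H_i$ for which $\pi_{b_i}$ is smallest among all $i$ with $d_i<x<b_i$, or the sky color if there is no such $i$. Let $q_i$ be the number of points given the color of $H_i$ ($1\le i\le k$), and $q_0$ the number of points given the color of the sky. Then $(q_0,\ldots,q_k)$ is a composition of $n-k$ into $k+1$ parts, said to be induced by the valid hook configuration. The valid compositions of $\pi$ are the compositions induced by valid hook configurations of $\pi$. Canonical valid hook configuration. It is constructed by choosing the northeast endpoints of $H_k^*,H_{k-1}^*,\ldots,H_1^*$ in this order: for each $\ell$, given $H_{\ell+1}^*,\ldots,H_k^*$, consider all points of the plot that could be the northeast endpoint of $H_\ell^*$ (the hook with southwest endpoint $(d_\ell,\pi_{d_\ell})$) so that conditions 2 and 3 hold for $H_\ell^*,\ldots,H_k^*$, and choose the leftmost one. When $\pi$ is sorted this procedure succeeds and produces a valid hook configuration $\mathcal H^*=(H_1^*,\ldots,H_k^* )$. Parameters. For $1\le i\le k+1$, the $i$-th ascending run of $\pi$ is $\pi_{d_{i-1}+1}\cdots\pi_{d_i}$. Let $(b_i^*,\pi_{b_i^*})$ be the northeast endpoint of $H_i^*$. Let $(q_0^*,\ldots,q_k^* )$ be the valid composition induced by $\mathcal H^*$. For $1\le i\le k$, let $e_i$ be the index such that $\pi_{b_i^*}$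 is in the $e_i$-th ascending run, i.e. $d_{e_i-1}<b_i^*\le d_{e_i}$; put $e_0=k+1$. For $1\le j\le k+1$, let $\alpha_j=|\{i\in\{1,\ldots,k\}: e_i=j\}|$. *)

(* Defs.v *)
From mathcomp Require Import all_boot all_order all_algebra.
From mathcomp Require Import reals.

Set Implicit Arguments.
Unset Strict Implicit.
Unset Printing Implicit Defensive.

(* Permutations are words over nat.  Positions, values, descents, hooks and
   ascending runs are numbered from 1, as in the mathematics, so entry i sits
   at list index i.-1. *)
Definition is_perm (n : nat) (w : seq nat) : Prop := perm_eq w (iota 1 n).

Definition entry (w : seq nat) (i : nat) : nat := nth 0 w i.-1.

(* The number m bounds the recursion depth; any m >= size w gives the same
   result (stack_sort_rec_depth).  The defining recursion of the stack-sorting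
   map is stack_sort_nil together with stack_sort_cat. *)
Fixpoint stack_sort_rec (m : nat) (w : seq nat) : seq nat :=
  match m, w with
  | m'.+1, _ :: _ =>
      let N := \max_(x <- w) x in
      let i := index N w in
      stack_sort_rec m' (take i w) ++ stack_sort_rec m' (drop i.+1 w) ++ [:: N]
  | _, _ => [::]
  end.

Definition stack_sort (w : seq nat) : seq nat := stack_sort_rec (size w) w.

Lemma stack_sort_nil : stack_sort [::] = [::].
Proof. by []. Qed.

Lemma stack_sort_recS (m : nat) (w : seq nat) : 0 < size w ->
  stack_sort_rec m.+1 w =
    let N := \max_(x <- w) x in let i := index N w in
    stack_sort_rec m (take i w) ++ stack_sort_rec m (drop i.+1 w) ++ [:: N].
Proof. by case: w. Qed.

Lemma stack_sort_rec_cat (m : nat) (L R : seq nat) (N : nat) :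
  all (fun x => x < N) (L ++ R) ->
  stack_sort_rec m.+1 (L ++ N :: R)
  = stack_sort_rec m L ++ stack_sort_rec m R ++ [:: N].
Proof.
rewrite all_cat => /andP[/allP HL /allP HR].
have maxE : \max_(x <- L ++ N :: R) x = N.
  apply/eqP; rewrite eqn_leq; apply/andP; split.
    apply/bigmax_leqP_seq => x; rewrite mem_cat inE.
    by case/or3P => [/HL /ltnW|/eqP ->|/HR /ltnW].
  by apply: (@leq_bigmax_seq _ _ xpredT id) => //; rewrite mem_cat inE eqxx orbT.
have idx : index N (L ++ N :: R) = size L.
  rewrite index_cat /= eqxx addn0.
  by case: ifP => // /HL; rewrite ltnn.
rewrite stack_sort_recS ?size_cat /= ?addnS // maxE idx take_size_cat //.
by rewrite -(cat_rcons N L R) drop_size_cat // size_rcons.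
Qed.

Lemma stack_sort_rec_depth (m1 m2 : nat) (w : seq nat) :
  uniq w -> size w <= m1 -> size w <= m2 ->
  stack_sort_rec m1 w = stack_sort_rec m2 w.
Proof.
elim: m1 m2 w => [|m1 IH] m2 w; first by case: w => [|x w] // _ _; case: m2.
case: w => [|x w] uw; first by case: m2.
case: m2 => [|m2] // h1 h2.
rewrite !stack_sort_recS //.
set v := x :: w in uw h1 h2 *.
set N := \max_(y <- v) y; set i := index N v.
have Nv : N \in v.
  rewrite /N /v; elim: (w) (x) => [|y s IHs] z.
    by rewrite big_cons big_nil maxn0 inE.
  rewrite big_cons; case: (leqP z (\max_(j <- y :: s) j)) => h.
    by rewrite inE IHs orbT.
  by rewrite inE eqxx.
have iv : i < size v by rewrite index_mem.
have st : size (take i v) < size v by rewrite size_takel // ltnW.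
have sd : size (drop i.+1 v) < size v by rewrite size_drop ltn_subrL (leq_ltn_trans _ iv).
cbv zeta; rewrite -/i; congr (_ ++ (_ ++ _)); apply: IH.
- exact: take_uniq uw.
- exact: leq_trans st h1.
- exact: leq_trans st h2.
- exact: drop_uniq uw.
- exact: leq_trans sd h1.
- exact: leq_trans sd h2.
Qed.

Lemma stack_sort_cat (L R : seq nat) (N : nat) :
  uniq (L ++ N :: R) -> all (fun x => x < N) (L ++ R) ->
  stack_sort (L ++ N :: R) = stack_sort L ++ stack_sort R ++ [:: N].
Proof.
move=> uw lt; rewrite /stack_sort size_cat /= addnS stack_sort_rec_cat //.
move: uw; rewrite cat_uniq /= => /and3P[uL _ /andP[_ uR]].
by congr (_ ++ (_ ++ _)); apply: stack_sort_rec_depth; rewrite ?leq_addr ?leq_addl.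
Qed.

Definition stack_sorted (w : seq nat) : Prop :=
  exists2 v : seq nat, is_perm (size w) v & stack_sort v = w.

Definition descents (w : seq nat) : seq nat :=
  [seq i <- iota 1 (size w).-1 | entry w i.+1 < entry w i].

(* d_0 = 0, d_1 < ... < d_k the descents, d_{k+1} = n. *)
Definition dpos (w : seq nat) (i : nat) : nat :=
  nth 0 (0 :: rcons (descents w) (size w)) i.

(* The hook from the point (i, w_i) to the point (j, w_j) is encoded as (i, j);
   a configuration (H_1, ..., H_k) is a list of such pairs. *)
Definition hook : Type := (nat * nat)%type.

Definition is_hook (w : seq nat) (h : hook) : bool :=
  [&& 1 <= h.1, h.1 < h.2, h.2 <= size w & entry w h.1 < entry w h.2].

Definition sw (H : seq hook) (i : nat) : nat := (nth (0, 0) H i.-1).1.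
Definition ne (H : seq hook) (i : nat) : nat := (nth (0, 0) H i.-1).2.

Section Plane.

Variable R : realType.
Local Open Scope ring_scope.

Definition plot_point (w : seq nat) (i : nat) : R * R :=
  (i%:R, (entry w i)%:R).

Definition on_hook (w : seq nat) (h : hook) (P : R * R) : bool :=
  let: (xsw, ysw) := plot_point w h.1 in
  let: (xne, yne) := plot_point w h.2 in
  ((P.1 == xsw) && (ysw <= P.2 <= yne)) || ((P.2 == yne) && (xsw <= P.1 <= xne)).

Definition no_point_above (w : seq nat) (h : hook) : Prop :=
  forall x : nat, (h.1 < x < h.2)%N -> ~ (entry w h.2 < entry w x)%N.

Definition compatible_hooks (w : seq nat) (h h' : hook) : Prop :=
  forall P : R * R, on_hook w h P -> on_hook w h' P ->
    (P = plot_point w h.2 /\ P = plot_point w h'.1) \/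
    (P = plot_point w h.1 /\ P = plot_point w h'.2).

(* Everything required of a valid hook configuration except that the southwest
   endpoints exhaust the descent tops. *)
Definition admissible (w : seq nat) (H : seq hook) : Prop :=
  [/\ forall h : hook, h \in H -> is_hook w h,
      forall h : hook, h \in H -> no_point_above w h &
      forall h h' : hook, h \in H -> h' \in H -> h <> h' ->
        compatible_hooks w h h'].

Definition valid_hook_config (w : seq nat) (H : seq hook) : Prop :=
  map fst H = descents w /\ admissible w H.

(* [drop l H] is (H_{l+1}, ..., H_k). *)
Definition canonical_hook_config (w : seq nat) (H : seq hook) : Prop :=
  map fst H = descents w /\
  forall l : nat, (1 <= l <= size H)%N ->
    let candidate b := admissible w ((dpos w l, b) :: drop l H) in
    candidate (ne H l) /\ (forall b : nat, candidate b -> (ne H l <= b)%N).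

End Plane.

Definition under_hook (H : seq hook) (x i : nat) : bool :=
  sw H i < x < ne H i.

(* Color 0 is the sky and color i >= 1 is that of H_i.  Since no point lies
   above a hook, the first hook seen from position x is the lowest one that
   spans x; the strict inequality sw H i < x makes a southwest endpoint ignore
   its own hook. *)
Definition has_color (w : seq nat) (H : seq hook) (x i : nat) : bool :=
  let hooks := iota 1 (size H) in
  if i == 0 then ~~ has (under_hook H x) hooks
  else under_hook H x i &&
       all (fun j => under_hook H x j ==>
              (entry w (ne H i) <= entry w (ne H j))) hooks.

Definition color_count (w : seq nat) (H : seq hook) (i : nat) : nat :=
  count (fun x => (x \notin map snd H) && has_color w H x i) (iota 1 (size w)).

Definition induced_composition (w : seq nat) (H : seq hook) : seq nat :=
  mkseq (color_count w H) (size H).+1.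

Definition is_composition (a b : nat) (q : seq nat) : Prop :=
  [/\ size q = a, all (fun x => 0 < x) q & sumn q = b].

Definition valid_composition (R : realType) (w q : seq nat) : Prop :=
  exists2 H : seq hook, valid_hook_config R w H & q = induced_composition w H.

Definition run_index (w : seq nat) (x : nat) : nat :=
  head 0 [seq j <- iota 1 (size (descents w)).+1 | dpos w j.-1 < x <= dpos w j].

Definition eparam (w : seq nat) (H : seq hook) (i : nat) : nat :=
  if i == 0 then (size H).+1 else run_index w (ne H i).

Definition alpha (w : seq nat) (H : seq hook) (j : nat) : nat :=
  count (fun i => eparam w H i == j) (iota 1 (size H)).

(* Main.v *)
(* A valid hook configuration is a choice of northeast endpoints b_i > d_i such
   that pi_{b_i} is the maximum of pi on [d_i, b_i] and, for i < j, either
   b_i <= d_j or b_j < b_i.  By downward induction the canonical endpoints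
   satisfy b*_i <= b_i, since b_i is always a candidate for b*_i; counting the
   points in (d_m, b*_m) and in (d_m, d_{p+1}], all of which lie below H_m,
   gives (a) and (b).  Conversely, read q as a lattice path with one up step per
   position and q_i + 1 down steps right after d_i, and let b_l be the first
   return of the path to its height at d_l.  First returns are laminar and
   induce q, while (a) and (b) force b*_l <= b_l, from which the maximality of
   pi_{b_l} follows. *)
Require Import Defs.
From mathcomp Require Import all_boot all_order all_algebra.
From mathcomp Require Import reals.
From mathcomp Require Import zify.

Set Implicit Arguments.
Unset Strict Implicit.
Unset Printing Implicit Defensive.

(** * Counting over intervals and by colour *)

Lemma sum_count_pred_eq (T : Type) (P : pred T) (c : T -> nat) (s : seq T) a b :
  \sum_(a <= j < b) count (fun x => P x && (c x == j)) s
  = count (fun x => P x && (a <= c x < b)) s.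
Proof.
elim: s => [|x s IH] /=; first by rewrite big1.
rewrite big_split /= IH; congr (_ + _).
case: (P x) => /=; last by rewrite big1.
case: (boolP (a <= c x < b)) => h.
  rewrite (bigD1_seq (c x)) ?iota_uniq ?mem_index_iota //= eqxx big1 // => i.
  by rewrite eq_sym => /negPf->.
rewrite big_seq big1 // => i; rewrite mem_index_iota => hi.
by case: eqP => // E; rewrite E hi in h.
Qed.

Lemma count_iota_split (P : pred nat) n u v : 0 < u -> u <= v -> v <= n.+1 ->
  count P (iota 1 n)
  = count P (iota 1 u.-1) + count P (iota u (v - u)) + count P (iota v (n.+1 - v)).
Proof.
move=> u0 uv vn.
have -> : n = u.-1 + ((v - u) + (n.+1 - v)) by lia.
rewrite !iotaD !count_cat addnA.
by congr (count _ (iota _ _) + count _ (iota _ _) + count _ (iota _ _)); lia.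
Qed.

(** * The colour of a position *)

Section Color.

Variables (k : nat) (d b : nat -> nat).

(* Hooks over x are nested, so the lowest one is the one that starts last; the
   empty maximum 0 is the sky. *)
Definition color (x : nat) : nat :=
  \max_(1 <= j < k.+1 | d j < x < b j) j.

Lemma color_gt0 x : 0 < color x ->
  [/\ color x <= k, d (color x) < x & x < b (color x)].
Proof.
move=> h; suff: color x = 0 \/ [/\ color x <= k, d (color x) < x & x < b (color x)].
  by case=> // E; rewrite E in h.
rewrite /color big_seq_cond.
elim/big_ind: _ => [|u v hu hv|i]; first by left.
  by rewrite /maxn; case: ifP.
by rewrite mem_index_iota => /andP[hi /andP[h1 h2]]; right; split => //; lia.
Qed.

Lemma leq_color x j : 0 < j <= k -> d j < x < b j -> j <= color x.
Proof.
move=> hj hx; apply: (@leq_bigmax_seq _ _ (fun j => d j < x < b j) id) => //.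
by rewrite mem_index_iota; lia.
Qed.

End Color.

(** * Hook configurations as functions giving the northeast endpoints *)

Section NestedHooks.

Variables (f : nat -> nat) (n k : nat) (d : nat -> nat).

(* Valid configurations of the hooks H_{l+1}, ..., H_k only, as they occur in the
   construction of the canonical configuration. *)
Definition nested (l : nat) (b : nat -> nat) : Prop :=
  (forall i, l < i <= k -> d i < b i <= n /\
     forall x, d i <= x <= b i -> f x <= f (b i)) /\
  (forall i j, l < i -> i < j -> j <= k -> b i <= d j \/ b j < b i).

Definition is_ne (b : nat -> nat) (x : nat) : bool := x \in [seq b i | i <- iota 1 k].

Definition color_size (b : nat -> nat) (i : nat) : nat :=
  count (fun x => ~~ is_ne b x && (color k d b x == i)) (iota 1 n).

(* Treats the sky as a hook of index 0 from (0, 0) with northeast endpoint at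
   abscissa n + 1. *)
Definition hook_end (b : nat -> nat) (m : nat) : nat := if m == 0 then n.+1 else b m.

Lemma eq_nested l b b' : (forall i, 0 < i <= k -> b i = b' i) ->
  nested l b -> nested l b'.
Proof.
move=> E [b1 b2]; split=> [i hi|i j hi ij jk]; first by rewrite -E; [exact: b1 | lia].
by rewrite -!E; [exact: b2 | lia | lia].
Qed.

Lemma eq_color_size b b' i : (forall i, 0 < i <= k -> b i = b' i) ->
  color_size b i = color_size b' i.
Proof.
move=> E; apply: eq_count => x; rewrite /is_ne /color /=; congr (~~ _ && _).
  by congr (_ \in _); apply/eq_in_map => j; rewrite mem_iota => hj; rewrite E //; lia.
congr (_ == _); rewrite big_nat_cond [RHS]big_nat_cond; apply: eq_bigl => j.
by case: (boolP (_ <= _ < _)) => //= hj; rewrite E.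
Qed.

Hypothesis d0 : d 0 = 0.
Hypothesis dn : d k.+1 = n.
Hypothesis d_lt : forall i j, i < j -> j <= k.+1 -> d i < d j.

Lemma d_le i j : i <= j -> j <= k.+1 -> d i <= d j.
Proof. by rewrite leq_eqVlt => /orP[/eqP->|h] // /(d_lt h)/ltnW. Qed.

Lemma d_le_n i : i <= k.+1 -> d i <= n.
Proof. by move=> h; rewrite -dn d_le. Qed.

Lemma d_lt_inv i j : i <= k.+1 -> d i < d j -> i < j.
Proof. by move=> hi h; rewrite ltnNge; apply/negP => /d_le/(_ hi); lia. Qed.

Lemma d_run x : 0 < x <= n -> exists2 e, e <= k & d e < x <= d e.+1.
Proof.
move=> hx.
have: exists e, x <= d e.+1 by exists k; rewrite dn; lia.
case/ex_minnP=> e he emin.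
have ek : e <= k by apply: emin; rewrite dn; lia.
exists e => //; rewrite he andbT ltnNge; apply/negP => hd.
case: e he emin ek hd => [|e] he emin ek hd; first by move: hd; rewrite d0; lia.
by have := emin _ hd; lia.
Qed.

(** * Colour counts of a nested configuration *)

Section Counting.

Variable b : nat -> nat.
Hypothesis nb : nested 0 b.

Lemma is_neP x : reflect (exists2 i, 0 < i <= k & b i = x) (is_ne b x).
Proof.
apply: (iffP mapP) => -[i hi E]; exists i => //; rewrite ?mem_iota in hi *; lia.
Qed.

Lemma ne_inj i j : 0 < i <= k -> 0 < j <= k -> b i = b j -> i = j.
Proof.
case: nb => nb1 nb2 hi hj E; case: (ltngtP i j) => // h.
  by have := nb1 j; have := nb2 i j; lia.
by have := nb1 i; have := nb2 j i; lia.
Qed.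

Lemma ne_below_hook_end m j : m < j <= k -> d j < hook_end b m -> b j < hook_end b m.
Proof.
rewrite /hook_end; case: eqP => [-> hj _|m0 hj].
  by have [/(_ j) + _] := nb; lia.
by have [_ /(_ m j)] := nb; lia.
Qed.

Lemma hook_end_le m : m <= k -> hook_end b m <= n.+1.
Proof.
by rewrite /hook_end; case: eqP => // m0 mk; have [/(_ m) + _] := nb; lia.
Qed.

(** A hook starting before [d m] and ending after it must, by nesting, end beyond [b m], and a hook
    of index above [p] ends too late. So only [m+1, ..., p] contribute endpoints below [y]. *)
Lemma ne_count m p y : m <= p <= k -> d m < y -> y <= hook_end b m ->
  y <= (d p.+1).+1 ->
  count (is_ne b) (iota (d m).+1 (y - (d m).+1))
  = count (fun j => b j < y) (iota m.+1 (p - m)).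
Proof.
move=> mpk dmy yb yd; have [nb1 nb2] := nb.
rewrite -!size_filter -[RHS](size_map b).
apply/perm_size/uniq_perm; first by rewrite filter_uniq ?iota_uniq.
  rewrite map_inj_in_uniq ?filter_uniq ?iota_uniq // => i j.
  by rewrite !mem_filter !mem_iota => hi hj; apply: ne_inj; lia.
move=> x; rewrite mem_filter mem_iota; apply/andP/mapP.
  case=> /is_neP[j hj <-] hx; exists j => //.
  rewrite mem_filter mem_iota.
  have djb := nb1 j hj.
  have jp : j <= p.
    by rewrite -ltnS; apply: d_lt_inv; lia.
  have mj : m < j; last by lia.
  rewrite ltnNge; apply/negP => jm.
  have m0 : 0 < m by lia.
  move: yb; rewrite /hook_end; case: eqP => [|_] yb; first by lia.
  move: jm; rewrite leq_eqVlt => /orP[/eqP E|jm]; first by subst; lia.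
  by have := nb2 j m; lia.
case=> j; rewrite mem_filter mem_iota => hj ->; split.
  by apply/is_neP; exists j => //; lia.
have := nb1 j; have := @d_lt m j; lia.
Qed.

Lemma sum_color_size m p : \sum_(m <= j < p.+1) color_size b j
  = count (fun x => ~~ is_ne b x && (m <= color k d b x < p.+1)) (iota 1 n).
Proof. exact: sum_count_pred_eq. Qed.

(** Such an [x] lies under hook [m], which bounds its colour from below; only hooks of index at most
    [p] start before [x]. *)
Lemma color_between m p y x : m <= p <= k -> y <= hook_end b m ->
  y <= (d p.+1).+1 -> d m < x < y -> m <= color k d b x < p.+1.
Proof.
move=> mpk yb yd hx; apply/andP; split.
  case: (posnP m) => [->//|m0]; apply: leq_color; first by lia.
  by move: yb; rewrite /hook_end; case: eqP; lia.
case: (posnP (color k d b x)) => [->//|/color_gt0[h1 h2 h3]].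
by apply: d_lt_inv; lia.
Qed.

Lemma count_color_between m p y : m <= p <= k -> d m < y -> y <= hook_end b m ->
  y <= (d p.+1).+1 ->
  count (fun x => ~~ is_ne b x && (m <= color k d b x < p.+1))
      (iota (d m).+1 (y - (d m).+1))
    + count (fun j => b j < y) (iota m.+1 (p - m)) = y - (d m).+1.
Proof.
move=> mpk dmy yb yd; rewrite -(ne_count mpk dmy yb yd).
rewrite -[RHS](size_iota (d m).+1) -(count_predC (is_ne b)) addnC; congr (_ + _).
apply: eq_in_count => x; rewrite mem_iota /= => hx.
by rewrite (@color_between m p y) ?andbT //; lia.
Qed.

(** Every position strictly between [d m] and [y] is either a northeast endpoint or has a colour in
    [m..p]; positions outside can only enlarge the sum. *)
Lemma sum_color_size_ge m p y : m <= p <= k -> d m < y -> y <= hook_end b m ->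
  y <= (d p.+1).+1 ->
  y <= \sum_(m <= j < p.+1) color_size b j + (d m).+1
       + count (fun j => b j < y) (iota m.+1 (p - m)).
Proof.
move=> mpk dmy yb yd; have E := count_color_between mpk dmy yb yd.
rewrite sum_color_size (@count_iota_split _ n (d m).+1 y) //; first lia.
by have := @hook_end_le m; lia.
Qed.

(** With [y] the end of hook [m] and [p+1] the run containing it, the inequality is tight: hooks
    [m+1, ..., p] all end before hook [m], so their colours stay under it. The slack [(d p.+1).+1]
    admits the sky, which ends at [n+1]. *)
Lemma sum_color_size_eq m p : m <= p <= k -> d p < hook_end b m ->
  hook_end b m <= (d p.+1).+1 ->
  \sum_(m <= j < p.+1) color_size b j + (d m).+1 + (p - m) = hook_end b m.
Proof.
move=> mpk dpb bd.
have dmp : d m <= d p by apply: d_le; lia.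
have dmb : d m < hook_end b m by lia.
have E := count_color_between mpk dmb (leqnn _) bd.
have all_ne : count (fun j => b j < hook_end b m) (iota m.+1 (p - m)) = p - m.
  rewrite -[RHS](size_iota m.+1); apply/eqP; rewrite -all_count.
  apply/allP => j; rewrite mem_iota => hj.
  by apply: ne_below_hook_end; [lia | have := @d_le j p; lia].
(* A position coloured [c] in [m..p] lies in the span of hook [c], which is contained in that of
   hook [m]. *)
have outside x : 0 < x <= n -> ~~ (d m < x < hook_end b m) ->
    ~~ (~~ is_ne b x && (m <= color k d b x < p.+1)).
  move=> hx ho; apply/negP => /and3P[ne mc cp].
  case: (posnP (color k d b x)) => [c0|c_gt0].
    by move: ho; rewrite /hook_end (_ : m = 0) ?d0 /=; lia.
  have [c1 c2 c3] := color_gt0 c_gt0.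
  have dmc : d m <= d (color k d b x) by apply: d_le; lia.
  have dcp : d (color k d b x) <= d p by apply: d_le; lia.
  have bce : b (color k d b x) <= hook_end b m; last by lia.
  case: (ltngtP m (color k d b x)) mc => // [mc _|Em _].
    by apply/ltnW/ne_below_hook_end; lia.
  by rewrite /hook_end -Em; case: eqP => // m0; lia.
have bn : hook_end b m <= n.+1 by apply: hook_end_le; lia.
rewrite sum_color_size (@count_iota_split _ n (d m).+1 (hook_end b m)) //.
rewrite (eq_in_count (a2 := pred0)) ?count_pred0; last first.
  by move=> x; rewrite mem_iota => hx; apply/negbTE/outside; lia.
rewrite (eq_in_count (a2 := pred0) (s := iota (hook_end b m) _)) ?count_pred0; last first.
  by move=> x; rewrite mem_iota => hx; apply/negbTE/outside; lia.
lia.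
Qed.

Lemma sum_color_size_all : \sum_(0 <= j < k.+1) color_size b j + k = n.
Proof.
have := @sum_color_size_eq 0 k; rewrite /hook_end /= dn d0 subn0.
by have := @d_le_n k; lia.
Qed.

End Counting.

(** * The canonical configuration and necessity of (a) and (b) *)

Hypothesis ascent : forall x, 0 < x < n ->
  (forall i, 0 < i <= k -> x <> d i) -> f x < f x.+1.

Variable bs : nat -> nat.
Hypothesis nbs : nested 0 bs.
Hypothesis bs_min : forall l c, 0 < l <= k ->
  nested l.-1 (fun i => if i == l then c else bs i) -> bs l <= c.

Lemma canonical_le b i : nested 0 b -> 0 < i <= k -> bs i <= b i.
Proof.
move=> [b1 b2]; have [bs1 bs2] := nbs.
suff H u l : k - l < u -> 0 < l <= k -> bs l <= b l by exact: H (ltnSn _).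
elim: u l => // u IH l hu hl; apply: bs_min => //; split=> [i' hi'|i' j hi ij hj].
  by case: eqP => [->|_]; [exact: b1 | apply: bs1; lia].
rewrite (_ : (j == l) = false); last by lia.
case: eqP => [E|_]; last by apply: bs2; lia.
(* Nesting survives when hook [l] ends at [b l] and the later hooks are canonical: if [b j < b l],
   then [bs j <= b j < b l] by induction. *)
have := b2 i' j; have := IH j; rewrite E; lia.
Qed.

Lemma hook_end_canonical_le b m : nested 0 b -> m <= k -> hook_end bs m <= hook_end b m.
Proof.
by move=> nb mk; rewrite /hook_end; case: eqP => // m0; apply: (canonical_le nb); lia.
Qed.

Variable es : nat -> nat.
Hypothesis es0 : es 0 = k.+1.
Hypothesis es_run : forall i, 0 < i <= k ->
  0 < es i <= k.+1 /\ d (es i).-1 < bs i <= d (es i).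

Lemma es_spec m : m <= k -> [/\ m < es m <= k.+1,
  d (es m).-1 < hook_end bs m & hook_end bs m <= (d (es m)).+1].
Proof.
move=> mk; rewrite /hook_end; case: eqP => [->|m0].
  by rewrite es0 /= dn; have := @d_le_n k; split; lia.
have [hm hb] := es_run (i := m) ltac:(lia).
have [nb1 _] := nbs; have := nb1 m.
by have := @d_lt_inv m (es m); split; lia.
Qed.

(** Condition (a). *)
Definition size_cond (q : nat -> nat) : Prop := forall m, m <= k ->
  \sum_(m <= j < es m) color_size bs j <= \sum_(m <= j < es m) q j.

(** Condition (b) without subtraction. The sum of the [alpha] is replaced by a count of canonical
    endpoints, which [count_run] justifies. *)
Definition run_cond (q : nat -> nat) : Prop := forall m p, m <= p -> p + 2 <= es m ->
  m <= k -> d p.+1 <= \sum_(m <= j < p.+1) q j + d m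
     + count (fun j => bs j <= d p.+1) (iota m.+1 (p - m)).

(** The tight count for the canonical hooks; through it (a) becomes a bound involving only the
    canonical endpoint of hook [m]. *)
Lemma sum_canonical m : m <= k ->
  \sum_(m <= j < es m) color_size bs j + (d m).+1 + (es m - m.+1) = hook_end bs m.
Proof.
move=> mk; have [he h1 h2] := es_spec mk.
have := @sum_color_size_eq bs nbs m (es m).-1; rewrite (_ : (es m).-1.+1 = es m); lia.
Qed.

(** Count up to the canonical end of hook [m], which does not exceed its actual end; at most
    [es m - m - 1] of the positions passed are northeast endpoints. *)
Lemma size_cond_nested b : nested 0 b -> size_cond (color_size b).
Proof.
move=> nb m mk; have := sum_canonical mk; have [he h1 h2] := es_spec mk.
have dmb : d m <= d (es m).-1 by apply: d_le; lia.
have := @sum_color_size_ge b nb m (es m).-1 (hook_end bs m).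
rewrite (_ : (es m).-1.+1 = es m); last by lia.
have := hook_end_canonical_le nb mk.
have := count_size (fun j => b j < hook_end bs m) (iota m.+1 ((es m).-1 - m)).
rewrite size_iota; lia.
Qed.

(** Count up to and including [d p.+1], which still lies under hook [m]. Since [bs j <= b j], no
    more endpoints of [b] than of [bs] occur there. *)
Lemma run_cond_nested b : nested 0 b -> run_cond (color_size b).
Proof.
move=> nb m p mp pe mk; have [he h1 h2] := es_spec mk.
have dmp : d m < d p.+1 by apply: d_lt; lia.
have dpe : d p.+1 <= d (es m).-1 by apply: d_le; lia.
have := @sum_color_size_ge b nb m p (d p.+1).+1.
have := hook_end_canonical_le nb mk.
suff : count (fun j => b j < (d p.+1).+1) (iota m.+1 (p - m)) <=
   count (fun j => bs j <= d p.+1) (iota m.+1 (p - m)) by lia.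
rewrite -!size_filter; apply: uniq_leq_size; first by rewrite filter_uniq ?iota_uniq.
move=> j; rewrite !mem_filter mem_iota => hj.
by have := @canonical_le b j nb; lia.
Qed.

(** A canonical hook ending in one of the runs [m+1..p+1] has index above [m]: an earlier one ending
    after [d m] would end beyond hook [m], hence beyond [d p.+1]. *)
Lemma count_run m p : m <= p -> p + 2 <= es m -> m <= k ->
  count (fun i => m < es i < p.+2) (iota 1 k)
  = count (fun j => bs j <= d p.+1) (iota m.+1 (p - m)).
Proof.
move=> mp pe mk; have [he h1 h2] := es_spec mk.
rewrite -!size_filter; apply/perm_size/uniq_perm; rewrite ?filter_uniq ?iota_uniq //.
move=> j; rewrite !mem_filter !mem_iota; apply/andP/andP => -[hj1 hj2]; last first.
  have [ej1 ej2] := es_run (i := j) ltac:(lia).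
  have [nb1 _] := nbs; have := nb1 j ltac:(lia).
  have := @d_lt_inv m (es j); have := @d_lt_inv (es j).-1 p.+1.
  by have := @d_le m j; lia.
have [ej1 ej2] := es_run (i := j) ltac:(lia).
have [nb1 nb2] := nbs; have := nb1 j ltac:(lia).
have de : d (es j) <= d p.+1 by apply: d_le; lia.
have dme : d m <= d (es j).-1 by apply: d_le; lia.
have dpe : d p.+1 <= d (es m).-1 by apply: d_le; lia.
have := @d_lt_inv j p.+1.
suff : m < j by lia.
rewrite ltnNge; apply/negP => jm.
case: (ltngtP j m) jm => // [jm|E] _; last by subst j; lia.
have := nb2 j m; move: h1; rewrite /hook_end; case: eqP; lia.
Qed.

(** * Sufficiency: first returns of the lattice path of a composition *)

Section Realize.

Variable q : nat -> nat.
Hypothesis q_gt0 : forall i, i <= k -> 0 < q i.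
Hypothesis q_sum : \sum_(0 <= j < k.+1) q j + k = n.
Hypothesis q_size : size_cond q.
Hypothesis q_run : run_cond q.

(** The number of down steps before [x]. Hook [i] accounts for [q i] coloured positions and its own
    northeast endpoint, hence the successor. *)
Definition weight (x : nat) : nat := \sum_(1 <= i < k.+1 | d i < x) (q i).+1.

(* The lattice path is at height x - weight x at x; with no subtraction, this
   says that it is at least as high at x as at d_l. *)
Definition returns (l x : nat) : bool := d l + weight x <= x + weight (d l).

Definition return_time (l : nat) : nat :=
  (d l).+1 + find (returns l) (iota (d l).+1 (n - d l)).

Lemma sumS a c : a <= c -> \sum_(a <= i < c) (q i).+1 = \sum_(a <= i < c) q i + (c - a).
Proof.
move=> ac; rewrite -(muln1 (c - a)) -[_ * 1]sum_nat_const_nat -big_split /=.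
by apply: eq_bigr => i _; rewrite addn1.
Qed.

Lemma weight_run a x : a <= k -> d a < x <= d a.+1 ->
  weight x = \sum_(1 <= i < a.+1) (q i).+1.
Proof.
move=> ak hx; rewrite /weight (@big_cat_nat _ _ _ a.+1) //=; try lia.
rewrite [X in _ + X]big_seq_cond [X in _ + X]big_pred0 ?addn0; last first.
  move=> i; rewrite mem_index_iota; apply/negbTE/negP => /andP[hi].
  by have := @d_le a.+1 i; lia.
rewrite big_seq_cond [RHS]big_seq; apply: eq_bigl => i.
rewrite mem_index_iota; case: (boolP (_ < _ < _)) => //= hi.
by have := @d_le i a; lia.
Qed.

Lemma weight_d l : 0 < l <= k -> weight (d l) = \sum_(1 <= i < l) (q i).+1.
Proof.
move=> hl; have E : l.-1.+1 = l by lia.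
by rewrite (@weight_run l.-1) ?E ?leqnn ?andbT ?d_lt //; lia.
Qed.

Lemma leq_weight x y : x <= y -> weight x <= weight y.
Proof.
move=> xy; rewrite /weight [X in X <= _]big_mkcond [X in _ <= X]big_mkcond /=.
by apply: leq_sum => i _; case: ifP => // h; rewrite ifT //; lia.
Qed.

(** The path ends at height [q 0], because the total is [n]. Its height at [d l] is at most [q 0] by
    (b) with [m = 0] and [p = l-1], the count there being at most [l-1]. *)
Lemma returns_n l : 0 < l <= k -> returns l n.
Proof.
move=> hl; rewrite /returns weight_d // (@weight_run k); last 2 first; try lia.
- by rewrite -dn leqnn andbT d_lt; lia.
rewrite !sumS; try lia.
have := @q_run 0 l.-1; rewrite es0 d0 (_ : l.-1.+1 = l); last by lia.
have := count_size (fun j => bs j <= d l) (iota 1 (l.-1 - 0)); rewrite size_iota.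
rewrite big_ltn; last by lia.
move: q_sum; rewrite big_ltn //.
have := @d_le_n l; lia.
Qed.

Lemma return_timeP l : 0 < l <= k ->
  [/\ d l < return_time l <= n, returns l (return_time l) &
   forall x, d l < x < return_time l -> ~~ returns l x].
Proof.
move=> hl; have dl : d l < n by rewrite -dn d_lt; lia.
(* The search succeeds by position [n], so [find] does not return its default. *)
have hs : has (returns l) (iota (d l).+1 (n - d l)).
  apply/hasP; exists n; rewrite ?returns_n // mem_iota; lia.
have := hs; rewrite has_find size_iota => hf.
split; rewrite /return_time; first by lia.
  by have := nth_find 0 hs; rewrite nth_iota.
move=> x hx; have := @before_find _ 0 (returns l) (iota (d l).+1 (n - d l)) (x - (d l).+1).
rewrite nth_iota; last by lia.
by rewrite subnKC => [->|]; lia.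
Qed.

(** The path rises by at most one per position, so it cannot jump over the height at [d l]; and it
    is strictly below right after [d l] because [q l > 0]. *)
Lemma return_time_eq l : 0 < l <= k ->
  return_time l + weight (d l) = d l + weight (return_time l).
Proof.
move=> hl; have [h1 h2 h3] := return_timeP hl.
have := h2; rewrite /returns.
have E : return_time l = (return_time l).-1.+1 by lia.
case: (leqP (return_time l).-1 (d l)) => h.
  have {}E : return_time l = (d l).+1 by lia.
  move: h2; rewrite /returns E weight_d // (@weight_run l); last 2 first; try lia.
  - by have := @d_lt l l.+1; lia.
  by rewrite big_nat_recr /=; [have := @q_gt0 l; lia|lia].
have := h3 (return_time l).-1; rewrite /returns.
have := @leq_weight (return_time l).-1 (return_time l); lia.
Qed.

Lemma return_time_sum l e : 0 < l <= k -> e <= k ->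
  d e < return_time l <= d e.+1 ->
  l <= e /\ \sum_(l <= j < e.+1) q j + (e.+1 - l) + d l = return_time l.
Proof.
move=> hl ek he; have [h1 h2 h3] := return_timeP hl.
have le : l <= e by rewrite -ltnS; apply: d_lt_inv; lia.
split=> //; have := return_time_eq hl; rewrite weight_d // (weight_run ek he).
rewrite (@big_cat_nat _ _ _ l 1 e.+1) /=; try lia.
have := @sumS l e.+1; lia.
Qed.

(** Suppose the return comes earlier. If it lies in the same run as [bs l], then (a) and
    [sum_canonical] are contradicted. If it lies in an earlier run [e+1], then (b) with [m = l],
    [p = e] puts [d e.+1] strictly before the return. *)
Lemma canonical_le_return_time l : 0 < l <= k -> bs l <= return_time l.
Proof.
move=> hl; have [h1 h2 h3] := return_timeP hl.
have [e ek he] := d_run (x := return_time l) ltac:(lia).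
have [le E] := return_time_sum hl ek he.
rewrite leqNgt; apply/negP => hlt.
have lk : l <= k by lia.
have [hes hes1 hes2] := es_spec lk.
have := sum_canonical lk; have := q_size lk.
have [_ hes3] := es_run hl.
move: hes1 hes2; rewrite /hook_end; case: eqP => [|_ hes1 hes2]; first by lia.
case: (ltngtP e.+1 (es l)) => [ltee|gtee|<-]; last by lia.
  have := @q_run l e le.
  have := count_size (fun j => bs j <= d e.+1) (iota l.+1 (e - l)); rewrite size_iota.
  lia.
have := @d_le (es l) e; lia.
Qed.

Lemma nested_return_time : nested 0 return_time.
Proof.
(* If [d j] precedes the return of [l], the path at [d j] is strictly below its height at [d l].
   Hence it is back at the height of [d j] strictly before it returns for [l]. *)
have laminar l j : 0 < l -> l < j -> j <= k ->
    return_time l <= d j \/ return_time j < return_time l.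
  move=> l0 lj jk; case: (leqP (return_time l) (d j)) => h; [by left | right].
  have [l1 l2 l3] := @return_timeP l ltac:(lia).
  have [j1 j2 j3] := @return_timeP j ltac:(lia).
  have := l3 (d j); rewrite d_lt ?h; try lia.
  move=> /(_ isT); rewrite /returns => hlj.
  rewrite ltnNge; apply/negP => hle.
  move: l2; rewrite /returns => l2.
  case: (ltngtP (return_time l) (return_time j)) hle => // hh _.
    by have := j3 (return_time l); rewrite /returns; lia.
  by have := @return_time_eq j; rewrite -hh; lia.
split=> [l hl|]; last by move=> l j; apply: laminar.
have [l1 l2 l3] := return_timeP hl; split=> // x hx.
have [bs1 _] := nbs; have [bl1 bl2] := bs1 l hl.
have cl := canonical_le_return_time hl.
(* The maximum over [d_l, b_l] is at or after bs l; were it before b_l it would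
   be a descent top, whose hook ends higher and still before b_l. *)
suff H u y : return_time l - y < u -> bs l <= y <= return_time l -> 
    f y <= f (return_time l).
  case: (leqP x (bs l)) => hxb; last by apply: (H (return_time l).+1); lia.
  apply: (@leq_trans (f (bs l))); first by apply: bl2; lia.
  by apply: (H (return_time l).+1); lia.
elim: u y => // u IH y hu hy.
case: (ltngtP y (return_time l)) hy => [ylt|//|->] hy; [|lia|by []].
case: (boolP (y \in [seq d i | i <- iota 1 k])) => [/mapP[j]|hy'].
  rewrite mem_iota => hj E; subst y.
  have lj : l < j by apply: d_lt_inv; lia.
  have := laminar l j; case=> //; try lia.
  move=> hjl; have [bj1 bj2] := bs1 j ltac:(lia).
  have cj := @canonical_le_return_time j ltac:(lia).
  have [j1 _ _] := @return_timeP j ltac:(lia).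
  apply: (@leq_trans (f (bs j))); first by apply: bj2; lia.
  by apply: IH; lia.
have : f y < f y.+1.
  apply: ascent; first by lia.
  move=> i hi E; case/negP: hy'; apply/mapP; exists i => //; rewrite mem_iota; lia.
have := IH y.+1; lia.
Qed.

(** Downward induction: [sum_color_size_eq] and [return_time_sum] give equal sums over [l..e], and
    all terms but the first agree already. The sky receives the remainder, as both totals are
    [n - k]. *)
Lemma color_size_return_time i : i <= k -> color_size return_time i = q i.
Proof.
have nb := nested_return_time.
have pos l : 0 < l <= k -> color_size return_time l = q l.
  suff H u l' : k - l' < u -> 0 < l' <= k -> color_size return_time l' = q l'.
    by exact: H (ltnSn _).
  elim: u l' => // u IH {}l hu hl.
  have [h1 _ _] := return_timeP hl.
  have [e ek he] := d_run (x := return_time l) ltac:(lia).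
  have [le E] := return_time_sum hl ek he.
  have := @sum_color_size_eq return_time nb l e.
  rewrite /hook_end; case: eqP => [|_]; first by lia.
  move: E; rewrite ![\sum_(l <= _ < _) _]big_ltn; try lia.
  rewrite (eq_big_nat (F1 := color_size return_time) _ _ (F2 := q)); last first.
    by move=> j hj; apply: IH; lia.
  lia.
case: i => [_|i hi]; last by apply: pos; lia.
have := sum_color_size_all nb; move: q_sum; rewrite ![\sum_(0 <= _ < _) _]big_ltn //.
rewrite (eq_big_nat (F1 := color_size return_time) _ _ (F2 := q)); last first.
  by move=> j hj; apply: pos; lia.
lia.
Qed.

End Realize.

End NestedHooks.

(** * From hooks in the plane to nested configurations *)

Section Bridge.

Import Order.TTheory GRing.Theory Num.Theory.

Variables (R : realType) (n : nat) (w : seq nat).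
Hypothesis hw : is_perm n w.
Hypothesis n_gt0 : 0 < n.

Let k := size (descents w).
Let d := dpos w.

Lemma size_perm : size w = n.
Proof. by rewrite (perm_size hw) size_iota. Qed.

Lemma entry_inj i j : 0 < i <= n -> 0 < j <= n -> entry w i = entry w j -> i = j.
Proof.
have uw : uniq w by rewrite (perm_uniq hw) iota_uniq.
rewrite -size_perm /entry => hi hj /eqP.
have li : i.-1 < size w by lia.
have lj : j.-1 < size w by lia.
by rewrite nth_uniq //; lia.
Qed.

Lemma mem_descents i : (i \in descents w) = (entry w i.+1 < entry w i) && (0 < i < n).
Proof. rewrite mem_filter mem_iota size_perm; congr (_ && _); lia. Qed.

Lemma dpos_lt i j : i < j -> j <= k.+1 -> d i < d j.
Proof.
move=> ij jk; rewrite /d /dpos.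
apply: (sorted_ltn_nth ltn_trans) => //; last 2 first.
- by rewrite inE /= size_rcons; rewrite /k in jk; lia.
- by rewrite inE /= size_rcons.
rewrite /= rcons_path path_sortedE; last exact: ltn_trans.
apply/andP; split.
  apply/andP; split; last by apply: sorted_filter; [exact: ltn_trans | exact: iota_ltn_sorted].
  by apply/allP => x; rewrite mem_descents; lia.
case: (lastP (descents w)) (mem_descents) => [|s x] /=; first by rewrite size_perm.
by move=> /(_ x); rewrite last_rcons mem_rcons inE eqxx size_perm /=; lia.
Qed.

Lemma dposS i : i < k -> d i.+1 = nth 0 (descents w) i.
Proof. by move=> ik; rewrite /d /dpos /= nth_rcons ik. Qed.

Lemma dpos_last : d k.+1 = n.
Proof. by rewrite /d /dpos /= nth_rcons ltnn eqxx size_perm. Qed.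

Lemma descents_dpos : descents w = [seq d i | i <- iota 1 k].
Proof.
apply: (@eq_from_nth _ 0); first by rewrite size_map size_iota.
move=> i hi; rewrite (nth_map 0) ?size_iota // nth_iota // add1n dposS //.
Qed.

Lemma dpos_ascent x : 0 < x < n -> (forall i, 0 < i <= k -> x <> d i) ->
  entry w x < entry w x.+1.
Proof.
move=> hx hd; rewrite ltnNge; apply/negP => hle.
have : x \in descents w.
  rewrite mem_descents hx andbT ltn_neqAle hle andbT; apply/eqP => /entry_inj; lia.
rewrite descents_dpos => /mapP[i]; rewrite mem_iota => hi; apply: hd; lia.
Qed.

Lemma compatible_hooks_sym h h' : compatible_hooks R w h h' -> compatible_hooks R w h' h.
Proof. by move=> H P h1 h2; case: (H P h2 h1) => -[? ?]; [right|left]. Qed.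

(** For the converse, a common point has abscissa at least [h'.1 > h.1], so it lies on the
    horizontal part of [h]. Then either it is the shared endpoint, or [h.2] is no higher than
    [h'.2], which lies under [h]. *)
Lemma compatible_hooksP (h h' : hook) :
  is_hook w h -> is_hook w h' -> no_point_above w h -> no_point_above w h' ->
  h.1 < h'.1 ->
  (compatible_hooks R w h h' <-> (h.2 <= h'.1 \/ h'.2 < h.2)).
Proof.
case: h h' => [a b] [a' b']; rewrite /is_hook size_perm /no_point_above /=.
move=> /and4P[a0 ab bn eab] /and4P[a0' ab' bn' eab'] na na' aa'; split.
  move=> H; case: (leqP b a') => h; first by left.
  right; rewrite ltnNge; apply/negP => bb'.
  (* This is where the horizontal part of [h] crosses the vertical part of [h']. *)
  have := H (a'%:R, (entry w b)%:R)%R; rewrite /on_hook /plot_point /=.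
  rewrite !ler_nat !eqxx /= (ltnW aa') (ltnW h) orbT => /(_ isT).
  have ea'b : entry w a' <= entry w b by rewrite leqNgt; apply/negP/na; lia.
  have ebb' : entry w b <= entry w b'.
    case: (ltngtP b b') bb' => // [bb' _|-> _]; last by [].
    by rewrite leqNgt; apply/negP/na'; lia.
  rewrite ea'b ebb' => /(_ isT) [] [[/eqP]]; rewrite eqr_nat; lia.
move=> H [x y]; rewrite /on_hook /plot_point /= => h h'.
have hx' : (a'%:R <= x <= b'%:R)%R /\ (y <= (entry w b')%:R)%R.
  case/orP: h' => /andP[/eqP-> h']; last by rewrite h'.
  by rewrite lexx ler_nat ltnW //; case/andP: h'.
have {}h : y = ((entry w b)%:R : R)%R /\ (x <= b%:R)%R.
  case/orP: h => /andP[/eqP E]; last by case/andP.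
  by move: hx'; rewrite E ler_nat => -[/andP[le_a'a _] _]; rewrite leqNgt aa' in le_a'a.
case: hx' h => /andP[hx1 hx2] hy [hy' hxb]; case: H => [H|H].
  have E : b = a'.
    apply/eqP; rewrite eqn_leq H /= -(ler_nat R); exact: le_trans hx1 hxb.
  have Ex : x = (b%:R : R)%R by apply/le_anti; rewrite hxb E hx1.
  by left; rewrite Ex hy' -E.
have ebb : entry w b <= entry w b' by rewrite -(ler_nat R) -hy'.
exfalso; clear x y h' hx1 hx2 hy hy' hxb.
have : entry w b' <= entry w b by rewrite leqNgt; apply/negP/na; lia.
by have := @entry_inj b b'; lia.
Qed.

Definition hooks (l : nat) (b : nat -> nat) : seq hook :=
  [seq (d i, b i) | i <- iota l.+1 (k - l)].

Lemma mem_hooks l b h : reflect (exists2 i, l < i <= k & h = (d i, b i)) (h \in hooks l b).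
Proof.
apply: (iffP mapP) => -[i hi E]; exists i => //; rewrite mem_iota in hi *; lia.
Qed.

(** As entries are distinct, being a hook with no point above it amounts to maximality of the
    northeast endpoint over the span; [compatible_hooksP] translates disjointness into nesting. *)
Lemma admissible_hooks l b :
  admissible R w (hooks l b) <-> nested (entry w) n k d l b.
Proof.
have hook_iff i : 0 < i <= k ->
    (is_hook w (d i, b i) /\ no_point_above w (d i, b i)) <->
    (d i < b i <= n /\ forall x, d i <= x <= b i -> entry w x <= entry w (b i)).
  move=> hi; have di : 0 < d i by have := @dpos_lt 0 i; rewrite {1}/d /dpos /=; lia.
  rewrite /is_hook /no_point_above /= size_perm di /=; split.
    case=> /and3P[h1 h2 h3] na; split=> [|x hx]; first by rewrite h1.
    case: (ltngtP x (d i)) => [|hx1|->]; [lia| |exact: ltnW].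
    case: (ltngtP x (b i)) => [hx2||->//]; last by lia.
    by rewrite leqNgt; apply/negP/na; lia.
  case=> /andP[h1 h2] hm; split; last by move=> x hx; apply/negP; rewrite -leqNgt hm; lia.
  rewrite h1 h2 /= ltn_neqAle hm ?leqnn ?(ltnW h1) // andbT.
  by apply/eqP => /entry_inj; lia.
split.
  case=> [A1 A2 A3].
  have mh i : l < i <= k -> (d i, b i) \in hooks l b by move=> hi; apply/mem_hooks; exists i.
  split=> [i hi|i j li ij jk].
    by apply/hook_iff; [lia | split; [apply: A1|apply: A2]; apply: mh].
  have dij : d i < d j by apply: dpos_lt; lia.
  have mi := mh i ltac:(lia); have mj := mh j ltac:(lia).
  apply/(compatible_hooksP (A1 _ mi) (A1 _ mj) (A2 _ mi) (A2 _ mj) dij)/A3 => //.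
  by case; lia.
case=> N1 N2.
have hk i : l < i <= k -> is_hook w (d i, b i) /\ no_point_above w (d i, b i).
  by move=> hi; apply/hook_iff; [lia | apply: N1].
have comp i j : l < i -> i < j -> j <= k -> compatible_hooks R w (d i, b i) (d j, b j).
  move=> li ij jk; have [i1 i2] := hk i ltac:(lia); have [j1 j2] := hk j ltac:(lia).
  by apply/compatible_hooksP => //=; [apply: dpos_lt; lia | apply: N2].
split=> [h /mem_hooks[i hi ->]|h /mem_hooks[i hi ->]|h h' /mem_hooks[i hi ->] /mem_hooks[j hj ->] ne].
- by case: (hk i hi).
- by case: (hk i hi).
case: (ltngtP i j) => [ij|ij|E]; last by case: ne; rewrite E.
  by apply: comp; lia.
by apply/compatible_hooks_sym/comp; lia.
Qed.

(** * Configurations given as lists of hooks *)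

Section Config.

Variable H : seq hook.
Hypothesis HH : map fst H = descents w.

Lemma size_config : size H = k.
Proof. by rewrite -(size_map fst) HH. Qed.

Lemma sw_config i : 0 < i <= k -> sw H i = d i.
Proof.
move=> hi; rewrite /sw -(nth_map _ 0) ?size_config; last by lia.
by rewrite HH -dposS; [congr d | ]; lia.
Qed.

Lemma drop_config l : l <= k -> drop l H = hooks l (ne H).
Proof.
move=> lk; apply: (@eq_from_nth _ (0, 0)).
  by rewrite size_drop size_map size_iota size_config.
move=> i; rewrite size_drop size_config => hi.
rewrite nth_drop (nth_map 0) ?size_iota // nth_iota // -sw_config; last by lia.
by rewrite /sw /ne /= -surjective_pairing; congr nth; lia.
Qed.

Lemma valid_config : valid_hook_config R w H <-> nested (entry w) n k d 0 (ne H).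
Proof.
rewrite /valid_hook_config -{2}(drop0 H) drop_config // admissible_hooks.
by split=> [[]|].
Qed.

(** Expresses one choice of the canonical construction in the form of the hypothesis [bs_min]. *)
Lemma admissible_candidate l c : 0 < l <= k ->
  admissible R w ((d l, c) :: drop l H)
  <-> nested (entry w) n k d l.-1 (fun i => if i == l then c else ne H i).
Proof.
move=> hl; rewrite -admissible_hooks drop_config; last by lia.
suff -> : hooks l.-1 (fun i => if i == l then c else ne H i)
          = (d l, c) :: hooks l (ne H) by [].
have E1 : k - l.-1 = (k - l).+1 by lia.
have E2 : l.-1.+1 = l by lia.
rewrite /hooks E1 E2 /= eqxx.
congr (_ :: _); apply/eq_in_map => i; rewrite mem_iota => hi.
by rewrite ifF //; lia.
Qed.

Hypothesis nH : nested (entry w) n k d 0 (ne H).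

(** Of two hooks over [x], the one starting later ends earlier, so its endpoint is under the other
    hook and, entries being distinct, strictly lower. *)
Lemma has_colorE x i : i <= k -> has_color w H x i = (color k d (ne H) x == i).
Proof.
move=> ik; have under j : 0 < j <= k -> under_hook H x j = (d j < x < ne H j).
  by move=> hj; rewrite /under_hook sw_config.
have [N1 N2] := nH.
have pos := @color_gt0 k d (ne H) x; have le := @leq_color k d (ne H) x.
rewrite /has_color size_config; case: eqP => [->|/eqP i0].
  rewrite -leqn0 leqNgt; congr (~~ _); apply/hasP/idP.
    case=> j; rewrite mem_iota => hj; rewrite under; last by lia.
    by move=> hu; apply: (leq_trans _ (le j _ hu)); lia.
  move=> c0; have [c1 c2 c3] := pos c0; exists (color k d (ne H) x).
    by rewrite mem_iota; lia.
  by rewrite under; lia.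
have i_gt0 : 0 < i <= k by lia.
rewrite under //; apply/andP/eqP.
  case=> hu /allP hall; have ic := le i i_gt0 hu.
  have [c1 c2 c3] := pos ltac:(lia).
  case: (ltngtP i (color k d (ne H) x)) ic => // ic _.
  have := hall (color k d (ne H) x); rewrite mem_iota under; last by lia.
  rewrite c2 c3 /= => /(_ ltac:(lia)) hle.
  have := N2 i (color k d (ne H) x); have [b1 b2] := N1 i i_gt0.
  have := b2 (ne H (color k d (ne H) x)); have [cb1 cb2] := N1 (color k d (ne H) x) ltac:(lia).
  by have := @entry_inj (ne H i) (ne H (color k d (ne H) x)); lia.
move=> E; have := pos; rewrite E => /(_ ltac:(lia))[c1 c2 c3]; split; first by lia.
apply/allP => j; rewrite mem_iota => hj; apply/implyP.
have hj' : 0 < j <= k by lia.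
rewrite under // => hu; have := le j hj' hu; rewrite E => ji.
have [b1 b2] := N1 j hj'; have [bi1 bi2] := N1 i i_gt0.
case: (ltngtP j i) ji => // [ji|->] _; last by [].
by apply: b2; have := N2 j i; lia.
Qed.

Lemma color_countE i : i <= k -> color_count w H i = color_size n k d (ne H) i.
Proof.
move=> ik; rewrite /color_count /color_size size_perm; apply: eq_count => x.
rewrite has_colorE //; congr (~~ _ && _); rewrite /is_ne; congr (_ \in _).
rewrite -{1}(drop0 H) drop_config // /hooks subn0 -map_comp; exact: eq_map.
Qed.

Lemma induced_compositionE :
  induced_composition w H = mkseq (color_size n k d (ne H)) k.+1.
Proof.
rewrite /induced_composition size_config; apply/eq_in_map => i.
by rewrite mem_iota => hi; apply: color_countE; lia.
Qed.

End Config.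

Lemma run_indexP x : 0 < x <= n ->
  0 < run_index w x <= k.+1 /\ d (run_index w x).-1 < x <= d (run_index w x).
Proof.
move=> hx; have [e ek he] := d_run (erefl : d 0 = 0) dpos_last hx.
rewrite /run_index; set s := [seq j <- _ | _].
(* The run of [x] is in the filtered list, so the default of [head] is not reached. *)
have : head 0 s \in s.
  have : e.+1 \in s by rewrite mem_filter mem_iota /= he; rewrite /k in ek; lia.
  by case: s => //= a s _; rewrite inE eqxx.
rewrite mem_filter mem_iota -/k -/d => /andP[-> h]; split=> //; lia.
Qed.

End Bridge.

Theorem theorem2p4 (R : realType) (n k : nat) (pi : seq nat)
    (hpi : is_perm n pi) (hsorted : stack_sorted pi)
    (hk : size (descents pi) = k)
    (Hstar : seq hook) (hHstar : canonical_hook_config R pi Hstar)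
    (q : seq nat) (hq : is_composition k.+1 (n - k) q) :
  let qstar := induced_composition pi Hstar in
  let d := dpos pi in
  let e := eparam pi Hstar in
  valid_composition R pi q <->
  (forall m : nat, m <= k ->
     \sum_(m <= j < e m) nth 0 q j >= \sum_(m <= j < e m) nth 0 qstar j) /\
  (forall m p : nat, m <= k -> p <= k -> m <= p -> p + 2 <= e m ->
     ((\sum_(m <= j < p.+1) nth 0 q j)%N%:Z >=
      (d p.+1)%:Z - (d m)%:Z -
      (\sum_(m.+1 <= j < p.+2) alpha pi Hstar j)%N%:Z)%R).
Proof.
move=> qstar d e; case: hq => size_q pos_q sum_q; subst k.
set k := size (descents pi) in size_q sum_q *.
have q_gt0 i : i <= k -> 0 < nth 0 q i.
  by rewrite -ltnS -size_q => iq; apply: (allP pos_q); apply: mem_nth.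
have sum_q' : \sum_(0 <= j < k.+1) nth 0 q j = n - k.
  by rewrite -sum_q sumnE [RHS](big_nth 0) size_q.
have n_gt0 : 0 < n by have := q_gt0 0; move: sum_q'; rewrite big_ltn //; lia.
(* Subtraction is truncated, so this is what turns the sum [n - k] into an equation with total
   [n]. *)
have k_lt : k < n.
  rewrite /k size_filter; apply: leq_ltn_trans (count_size _ _) _.
  by rewrite size_iota (size_perm hpi); lia.
have sum_qk : \sum_(0 <= j < k.+1) nth 0 q j + k = n by rewrite sum_q'; lia.
have d0 : d 0 = 0 by [].
have dn : d k.+1 = n := dpos_last hpi.
have d_lt i j : i < j -> j <= k.+1 -> d i < d j := @dpos_lt n pi hpi n_gt0 i j.
have [HH cand] := hHstar.
have size_H : size Hstar = k := size_config HH.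
(* The candidate list at [l = 1] is the whole canonical configuration. *)
have nbs : nested (entry pi) n k d 0 (ne Hstar).
  case: (posnP k) => [k0|k_gt0]; first by split=> *; lia.
  have [c1 _] := cand 1 ltac:(lia).
  have := proj1 (admissible_candidate R hpi n_gt0 HH (ne Hstar 1) (l := 1) k_gt0) c1.
  by apply: eq_nested => i _ /=; case: eqP => [->|].
have bs_min l c : 0 < l <= k ->
    nested (entry pi) n k d l.-1 (fun i => if i == l then c else ne Hstar i) ->
    ne Hstar l <= c.
  move=> hl hc; have [_] := cand l ltac:(lia); apply.
  exact: (proj2 (admissible_candidate R hpi n_gt0 HH c hl) hc).
have es0 : e 0 = k.+1 by rewrite /e /eparam size_H.
have es_run i : 0 < i <= k -> 0 < e i <= k.+1 /\ d (e i).-1 < ne Hstar i <= d (e i).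
  move=> hi; rewrite /e /eparam ifF; last by lia.
  by apply: (run_indexP hpi); have [/(_ i) + _] := nbs; lia.
have sum_alpha m p : m <= p -> p + 2 <= e m -> m <= k ->
    \sum_(m.+1 <= j < p.+2) alpha pi Hstar j
    = count (fun j => ne Hstar j <= d p.+1) (iota m.+1 (p - m)).
  move=> mp pe mk; rewrite -(count_run d0 dn d_lt nbs es0 es_run mp pe mk).
  rewrite -(sum_count_pred_eq predT); apply: eq_bigr => j _.
  by rewrite /alpha size_H.
have sum_qstar m : m <= k -> \sum_(m <= j < e m) nth 0 qstar j
    = \sum_(m <= j < e m) color_size n k d (ne Hstar) j.
  move=> mk; have [he _ _] := es_spec d0 dn d_lt nbs es0 es_run mk.
  apply: eq_big_nat => j hj; rewrite /qstar (induced_compositionE hpi n_gt0 HH nbs).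
  by rewrite nth_mkseq //; lia.
(* Conditions (a) and (b) of the statement in the forms [size_cond] and [run_cond], the integer
   differences being moved across the inequality. *)
have conds (r : nat -> nat) : (size_cond n k d (ne Hstar) e r /\ run_cond k d (ne Hstar) e r) <->
  (forall m : nat, m <= k ->
     \sum_(m <= j < e m) r j >= \sum_(m <= j < e m) nth 0 qstar j) /\
  (forall m p : nat, m <= k -> p <= k -> m <= p -> p + 2 <= e m ->
     ((\sum_(m <= j < p.+1) r j)%N%:Z >=
      (d p.+1)%:Z - (d m)%:Z -
      (\sum_(m.+1 <= j < p.+2) alpha pi Hstar j)%N%:Z)%R).
  split=> -[c1 c2]; split.
  - by move=> m mk; rewrite sum_qstar //; apply: c1.
  - by move=> m p mk _ mp pe; rewrite sum_alpha //; have := c2 m p mp pe mk; lia.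
  - by move=> m mk; rewrite -sum_qstar //; apply: c1.
  - move=> m p mp pe mk; have [he _ _] := es_spec d0 dn d_lt nbs es0 es_run mk.
    by have := c2 m p mk ltac:(lia) mp pe; rewrite sum_alpha //; lia.
rewrite -conds; split=> [[H [HHv vH] Eq]|[c1 c2]].
  have nH : nested (entry pi) n k d 0 (ne H) by apply/(valid_config R hpi n_gt0 HHv).
  have qE j : j <= k -> nth 0 q j = color_size n k d (ne H) j.
    by move=> jk; rewrite Eq (induced_compositionE hpi n_gt0 HHv nH) nth_mkseq.
  split=> [m mk|m p mp pe mk]; have [he _ _] := es_spec d0 dn d_lt nbs es0 es_run mk.
    rewrite [leqRHS](@eq_big_nat _ _ _ _ _ _ (color_size n k d (ne H))).
      exact: (size_cond_nested d0 dn d_lt nbs bs_min es0 es_run nH).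
    by move=> j hj; apply: qE; lia.
  rewrite (@eq_big_nat _ _ _ _ _ _ (color_size n k d (ne H))).
    exact: (run_cond_nested d0 dn d_lt nbs bs_min es0 es_run nH).
  by move=> j hj; apply: qE; lia.
have asc := dpos_ascent hpi n_gt0.
(* The witness: each hook ends at the first return of the path of [q]. *)
pose b := return_time n k d (nth 0 q); pose H := hooks pi 0 b.
have HHv : map fst H = descents pi.
  by rewrite /H /hooks subn0 -map_comp; exact: esym (descents_dpos pi).
have neE i : 0 < i <= k -> b i = ne H i.
  move=> hi; rewrite /ne /H /hooks subn0 (nth_map 0) ?size_iota -/k; last by lia.
  by rewrite nth_iota; [congr b|]; lia.
have nb : nested (entry pi) n k d 0 b.
  exact: (nested_return_time d0 dn d_lt asc nbs es0 es_run q_gt0 sum_qk c1 c2).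
have nH : nested (entry pi) n k d 0 (ne H) := eq_nested neE nb.
exists H; first by apply/(valid_config R hpi n_gt0 HHv).
rewrite (induced_compositionE hpi n_gt0 HHv nH); apply: (@eq_from_nth _ 0).
  by rewrite size_mkseq.
move=> i; rewrite size_q => hi; rewrite nth_mkseq // -(@eq_color_size n k d b (ne H) i neE).
by rewrite (color_size_return_time d0 dn d_lt asc nbs es0 es_run q_gt0 sum_qk c1 c2).
Qed.
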